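(* Let $\mathcal{C}\subseteq\{0,1\}^n$ be an extremal concept class. Then $\mathtt{r}(\mathcal{C})\leq 2\,\mathtt{vc}(\mathcal{C})+1$. Moreover: (i) every concept class $\mathcal{C}\subseteq\{0,1\}^n$ satisfies $\lfloor\log_2(2\mathtt{vc}(\mathcal{C})+2)\rfloor\leq \mathtt{r}(\mathcal{C})$; (ii) every maximum class $\mathcal{C}\subseteq\{0,1\}^n$ with $\mathcal{C}\neq\{0,1\}^n$ satisfies $\mathtt{vc}(\mathcal{C})+1\leq\mathtt{r}(\mathcal{C})$; (iii) for $\mathcal{C}=\{0,1\}^n$, $\lfloor\log_2(2\mathtt{vc}(\mathcal{C})+2)\rfloor=\mathtt{r}(\mathcal{C})$.
   Context: A concept class is a subset $\mathcal{C}\subseteq\{0,1\}^n$; each $c\in\mathcal{C}$ is a function $c:[n]\to\{0,1\}$. $\mathcal{C}$ shatters $A\subseteq[n]$ if every pattern in $\{0,1\}^A$ is realized as the restriction of some $c\in\mathcal{C}$ to $A$ (the empty set is always shattered); $\mathtt{vc}(\mathcal{C})$ is the largest size of a shattered set. $\mathcal{C}$ is extremal if $|\mathcal{C}|$ equals the number of subsets of $[n]$ shattered by $\mathcal{C}$, and maximum if $|\mathcal{C}|=\sum_{i=0}^{d}\binom{n}{i}$ where $d=\mathtt{vc}(\mathcal{C})$. Convexity space of $\mathcal{C}$: the ground set is $\mathcal{C}$; the half-spaces are the sets $\mathcal{C}_{x,y}=\{c\in\mathcal{C}:c(x)=y\}$ for $x\in[n]$, $y\in\{0,1\}$; the convex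 sets are arbitrary intersections of half-spaces (including $\mathcal{C}$ itself as the empty intersection). The convex hull $\mathtt{conv}(P)$ of $P\subseteq\mathcal{C}$ is the intersection of all convex sets containing $P$. Elements $c_1,\dots,c_k\in\mathcal{C}$ are Radon-independent if $\mathtt{conv}(\{c_i:i\in I\})\cap\mathtt{conv}(\{c_j:j\in J\})=\emptyset$ for every partition $I\cup J=[k]$ into two nonempty disjoint parts. The Radon number $\mathtt{r}(\mathcal{C})$ is the largest size of a Radon-independent set. *)

(* Defs.v *)
From mathcomp Require Export all_boot.

Set Implicit Arguments.
Unset Strict Implicit.
Unset Printing Implicit Defensive.

Notation concept n := {ffun 'I_n -> bool}.

Section ConceptClasses.
Variable n : nat.
Implicit Types (C P K I J : {set concept n}) (A : {set 'I_n}) (c : concept n).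

Definition restriction A c : {ffun {x : 'I_n | x \in A} -> bool} :=
  [ffun x => c (val x)].

Definition shatters C A : bool :=
  [forall p : {ffun {x : 'I_n | x \in A} -> bool},
     exists c in C, restriction A c == p].

(* The empty class shatters nothing, not even set0, and has vc = 0 here. *)
Definition vc C : nat := \max_(A : {set 'I_n} | shatters C A) #|A|.

Definition extremal C : Prop := #|C| = #|[set A : {set 'I_n} | shatters C A]|.

Definition maximum C : Prop := #|C| = \sum_(0 <= i < (vc C).+1) 'C(n, i).

Definition halfspace C (x : 'I_n) (y : bool) : {set concept n} :=
  [set c in C | c x == y].

Definition halfspaces C : {set {set concept n}} :=
  [set halfspace C x y | x : 'I_n, y : bool].

(* Half-spaces are subsets of C, so intersecting with C only matters for
   F = set0, where the intersection is meant to be C. *)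
Definition convex C K : bool :=
  [exists F : {set {set concept n}},
     (F \subset halfspaces C) && (K == C :&: \bigcap_(H in F) H)].

Definition conv C P : {set concept n} :=
  \bigcap_(K : {set concept n} | convex C K && (P \subset K)) K.

Definition radon_independent C P : bool :=
  [forall I : {set concept n}, forall J : {set concept n},
     [&& I :|: J == P, [disjoint I & J], I != set0 & J != set0] ==>
       (conv C I :&: conv C J == set0)].

Definition radon_number C : nat :=
  \max_(P : {set concept n} | (P \subset C) && radon_independent C P) #|P|.

End ConceptClasses.

(* Main.v *)
Require Import Defs.
From mathcomp Require Import all_boot ssralg zify.
Import GRing.Theory.

Set Implicit Arguments.
Unset Strict Implicit.
Unset Printing Implicit Defensive.

(* The upper bound is a Borsuk-Ulam argument with cubical chains modulo two.
   Subcubes contained in an extremal class C form a complex K of dimension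
   d = vc C, and the part of K inside any convex set is acyclic. Filling cycles
   gives, for points p_i (i in I, |I| = 2d + 2), a chain map f from the simplex
   on I to K with f(A) inside conv(p_a : a in A). If the points were
   Radon-independent, the products f(A) x f(B) over disjoint A, B would form an
   equivariant image of the sphere S^{2d} in K x K off the diagonal. Its
   fundamental class maps to a cycle of top dimension in K x K, hence to 0, so
   that the image of a hemisphere is symmetric; descending through the equators
   this contradicts the fact that S^0 is a pair of points.

   The lower bounds separate bipartitions by coordinates: an arbitrary class has
   a shattered set with one coordinate per bipartition of log_2(2d + 2) points;
   for the cube every bipartition of an independent set needs its own coordinate;
   and in a maximum class all d-sets are shattered, so a pattern missing on d + 1
   coordinates has all its neighbours present. *)

(** * Shattering *)

Section Shattering.
Variable n : nat.
Implicit Types (C : {set concept n}) (A S : {set 'I_n}) (c g : concept n).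
Implicit Types (x : 'I_n) (b : bool).

Lemma shattersP C A :
  reflect (forall g, exists2 c, c \in C & {in A, c =1 g}) (shatters C A).
Proof.
apply: (iffP forallP) => [sh g | sh p].
  have /existsP[c /andP[cC /eqP cp]] := sh (restriction A g).
  exists c => // x xA.
  by have /ffunP/(_ (Sub x xA)) := cp; rewrite !ffunE.
pose g : concept n := [ffun x => if insub x is Some u then p u else false].
have [c cC cg] := sh g; apply/existsP; exists c; rewrite cC /=.
apply/eqP/ffunP=> u; rewrite !ffunE cg ?(valP u) // ffunE.
by rewrite valK.
Qed.

Definition shattered C : {set {set 'I_n}} := [set A | shatters C A].

Lemma in_shattered C A : (A \in shattered C) = shatters C A.
Proof. by rewrite inE. Qed.

Lemma extremalE C : extremal C = (#|C| = #|shattered C|).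
Proof. by []. Qed.

(** * Splitting a class along one coordinate *)

Definition flip x c : concept n := [ffun i => if i == x then ~~ c i else c i].

Lemma flipK x : involutive (flip x).
Proof. by move=> c; apply/ffunP=> i; rewrite !ffunE; case: eqP => //; rewrite negbK. Qed.

Lemma flipx x c : flip x c x = ~~ c x.
Proof. by rewrite ffunE eqxx. Qed.

Lemma flip_neq x c i : i != x -> flip x c i = c i.
Proof. by rewrite ffunE => /negbTE ->. Qed.

Lemma in_halfspace C x b c : (c \in halfspace C x b) = (c \in C) && (c x == b).
Proof. by rewrite inE. Qed.

Definition flipped_half C x := flip x @: halfspace C x true.
(** Link and projection are normalised to the value [false] at [x], so that both stay inside the
    same cube; usually they live on the other coordinates. *)
Definition link C x := halfspace C x false :&: flipped_half C x.
Definition proj C x := halfspace C x false :|: flipped_half C x.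

Lemma in_flipped_half C x c :
  (c \in flipped_half C x) = (flip x c \in C) && (c x == false).
Proof.
apply/imsetP/andP => [[c' + ->]|[cC /eqP cx]].
  by rewrite in_halfspace flipK flipx => /andP[-> /eqP->].
by exists (flip x c); rewrite ?flipK // in_halfspace cC flipx cx.
Qed.

Lemma in_link C x c :
  (c \in link C x) = [&& c \in C, flip x c \in C & c x == false].
Proof.
rewrite inE in_halfspace in_flipped_half.
by case: (c \in C) (flip x c \in C) (c x == false) => [] [] [].
Qed.

Lemma card_halfspaces C x :
  #|halfspace C x false| + #|halfspace C x true| = #|C|.
Proof.
rewrite -(cardsID [set c : concept n | c x == false] C); congr addn; apply: eq_card => c.
  by rewrite !inE.
by rewrite !inE andbC; case: (c x).
Qed.

Lemma card_proj_link C x : #|proj C x| + #|link C x| = #|C|.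
Proof.
rewrite cardsUI card_imset; last exact: inv_inj (flipK x).
exact: card_halfspaces.
Qed.

Lemma shatters_const C x b A :
  {in C, forall c, c x = b} -> shatters C A -> x \notin A.
Proof.
move=> Cx /shattersP/(_ [ffun=> ~~ b]) [c cC cA]; apply/negP => xA.
by have := cA x xA; rewrite ffunE Cx //; case: (b).
Qed.

Lemma halfspace_shatters C x b A :
  shatters (halfspace C x b) A -> x \notin A /\ shatters C A.
Proof.
move=> sh; split.
  by apply: (shatters_const (b := b) _ sh) => c; rewrite in_halfspace => /andP[_ /eqP].
move/shattersP: sh => sh; apply/shattersP => g; have [c + cg] := sh g.
by rewrite in_halfspace => /andP[cC _]; exists c.
Qed.

(** The sets in [U] avoid [x] and the sets [x |: A] contain it, so nothing is counted twice.
    Half-spaces, link and projection all enter through this count. *)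
Lemma card_shattered_ge C x (U V : {set {set 'I_n}}) :
    (forall A, A \in U -> x \notin A /\ shatters C A) ->
    (forall A, A \in V -> x \notin A /\ shatters C (x |: A)) ->
  #|U| + #|V| <= #|shattered C|.
Proof.
move=> hU hV.
have injV : {in V &, injective (fun A => x |: A)}.
  move=> A B /hV[xA _] /hV[xB _] /(congr1 (fun D => D :\ x)).
  by rewrite !setU1K.
rewrite -(card_in_imset injV) -cardsUI.
have -> : U :&: [set x |: A | A in V] = set0.
  apply/setP=> B; rewrite !inE; apply/negP=> /andP[/hU[xB _] /imsetP[A _ eB]].
  by rewrite eB setU11 in xB.
rewrite cards0 addn0; apply: subset_leq_card; apply/subsetP => B.
rewrite inE in_shattered => /orP[/hU[]//|/imsetP[A /hV[_ sh] ->]//].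
Qed.

(** A set [A] shattered by both halves counts twice on the left; on the right it accounts for [A]
    and [x |: A]. *)
Lemma card_shattered_halfspaces C x :
  #|shattered (halfspace C x false)| + #|shattered (halfspace C x true)|
    <= #|shattered C|.
Proof.
rewrite -cardsUI; apply: (card_shattered_ge (x := x)) => A; rewrite !inE.
  by case/orP => /halfspace_shatters.
move=> /andP[sh0 sh1]; have [xA _] := halfspace_shatters sh0; split=> //.
apply/shattersP=> g.
have [c + cg] : exists2 c, c \in halfspace C x (g x) & {in A, c =1 g}.
  by case: (g x); [move/shattersP: sh1 | move/shattersP: sh0]; apply.
rewrite in_halfspace => /andP[cC /eqP cx]; exists c => // i.
by rewrite !inE => /orP[/eqP->//|/cg].
Qed.

Lemma proj_shatters C x A :
  shatters (proj C x) A -> x \notin A /\ shatters C A.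
Proof.
move=> sh; have xA : x \notin A.
  apply: (shatters_const (b := false) _ sh) => c.
  by rewrite inE in_halfspace in_flipped_half -andb_orl => /andP[_ /eqP].
split=> //; move/shattersP: sh => sh; apply/shattersP => g.
have [c + cg] := sh g; rewrite inE in_halfspace in_flipped_half -andb_orl.
case/andP => /orP[cC|cC] _; [by exists c|exists (flip x c) => // i iA].
by rewrite flip_neq ?cg //; apply: contraNneq xA => <-.
Qed.

Lemma link_shatters C x A :
  shatters (link C x) A -> x \notin A /\ shatters C (x |: A).
Proof.
move=> sh; have xA : x \notin A.
  apply: (shatters_const (b := false) _ sh) => c.
  by rewrite in_link => /and3P[_ _ /eqP].
split=> //; move/shattersP: sh => sh; apply/shattersP => g.
have [c + cg] := sh g; rewrite in_link => /and3P[cC fC /eqP cx].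
case gx : (g x); [exists (flip x c)|exists c] => // i; rewrite !inE => /orP[/eqP->|iA].
- by rewrite flipx cx gx.
- by rewrite flip_neq ?cg //; apply: contraNneq xA => <-.
- by rewrite cx gx.
- exact: cg.
Qed.

Lemma shatters0 C : shatters C set0 = (C != set0).
Proof.
apply/shattersP/set0Pn => [/(_ [ffun=> false]) [c cC _]|[c cC] g].
  by exists c.
by exists c => // x; rewrite inE.
Qed.

Lemma split_coordinate C : 1 < #|C| ->
  exists x, halfspace C x false != set0 /\ halfspace C x true != set0.
Proof.
move=> C1; have [c cC] : exists c, c \in C by apply/set0Pn; rewrite -card_gt0 ltnW.
have [c'] : exists c', c' \in C :\ c.
  by apply/set0Pn; rewrite -card_gt0; move: C1; rewrite (cardsD1 c C) cC.
rewrite !inE => /andP[nc c'C].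
have [x cx] : exists x, c' x != c x.
  apply/existsP; apply: contraR nc; rewrite negb_exists => /forallP h.
  by apply/eqP/ffunP => x; apply/eqP; have := h x; rewrite negbK.
have h b : halfspace C x b != set0.
  apply/set0Pn; have [e|e] := eqVneq (c x) b.
    by exists c; rewrite in_halfspace cC e eqxx.
  by exists c'; rewrite in_halfspace c'C /=; move: cx e; case: (c x) (c' x) b => [] [] [].
by exists x; split; exact: h.
Qed.

(* Pajor's inequality. *)
Lemma card_le_shattered C : #|C| <= #|shattered C|.
Proof.
elim/ltn_ind: {C}#|C| {-2}C (erefl #|C|) => m IH C Cm.
have [C1|C1] := leqP #|C| 1.
  case: (posnP #|C|) => [->//|C0]; apply: leq_trans C1 _.
  rewrite card_gt0; apply/set0Pn; exists set0.
  by rewrite in_shattered shatters0 -card_gt0.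
have [x []] := split_coordinate C1.
rewrite -!card_gt0 => h0 h1; have e := card_halfspaces C x.
rewrite -e; apply: leq_trans (card_shattered_halfspaces C x).
by apply: leq_add; apply: IH (erefl _); lia.
Qed.

(** Pajor's inequality for the two halves and the count of their shattered sets squeeze [#|C|], so
    each half attains equality. *)
Lemma extremal_halfspace C x b : extremal C -> extremal (halfspace C x b).
Proof.
rewrite !extremalE => eC.
have := card_halfspaces C x; have := card_shattered_halfspaces C x.
have := card_le_shattered (halfspace C x false).
have := card_le_shattered (halfspace C x true).
by case: b; lia.
Qed.

(** The same squeeze, with projection and link in place of the halves. *)
Lemma extremal_link C x : extremal C -> extremal (link C x).
Proof.
rewrite !extremalE => eC.
have := card_proj_link C x.
have := card_le_shattered (link C x); have := card_le_shattered (proj C x).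
have hU A : A \in shattered (proj C x) -> x \notin A /\ shatters C A.
  by rewrite in_shattered; exact: proj_shatters.
have hV A : A \in shattered (link C x) -> x \notin A /\ shatters C (x |: A).
  by rewrite in_shattered; exact: link_shatters.
by have := card_shattered_ge hU hV; lia.
Qed.

(** With an empty link the projection has as many elements as [C], yet [C] shatters at least one set
    more, namely [[set x]], against Pajor's inequality. *)
Lemma extremal_link_neq0 C x : extremal C ->
  halfspace C x false != set0 -> halfspace C x true != set0 -> link C x != set0.
Proof.
rewrite !extremalE => eC /set0Pn[c0 h0] /set0Pn[c1 h1].
apply/eqP => l0; have := card_proj_link C x; rewrite l0 cards0.
have := card_le_shattered (proj C x).
suff: #|shattered (proj C x)| + #|[set set0 : {set 'I_n}]| <= #|shattered C|.
  by rewrite cards1; lia.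
apply: (card_shattered_ge (x := x)) => A.
  by rewrite in_shattered; exact: proj_shatters.
rewrite in_set1 => /eqP->; rewrite inE; split=> //.
apply/shattersP => g.
have [c + cg] : exists2 c, c \in C & c x = g x.
  move: h0 h1; rewrite !in_halfspace => /andP[h0 /eqP e0] /andP[h1 /eqP e1].
  by case gx: (g x); [exists c1|exists c0].
by move=> cC; exists c => // i; rewrite !inE orbF => /eqP->.
Qed.

(** * Convex hulls as systems of coordinate constraints *)

Definition hull C (P : {set concept n}) : {set concept n} :=
  [set c in C | [forall p : 'I_n * bool,
     [forall a in P, a p.1 == p.2] ==> (c p.1 == p.2)]].

Lemma extremal_hull C P : extremal C -> extremal (hull C P).
Proof.
move=> eC; pose s := [seq p <- enum {: 'I_n * bool} | [forall a in P, a p.1 == p.2]].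
have -> : hull C P = [set c in C | all (fun p => c p.1 == p.2) s].
  apply/setP => c; rewrite !inE; congr andb; rewrite all_filter.
  apply/forallP/allP => h p; first by move=> _; exact: h.
  by apply: h; rewrite mem_enum.
elim: s => [|[x b] s IH] /=.
  suff -> : [set c in C | true] = C by [].
  by apply/setP=> c; rewrite inE andbT.
suff -> : [set c in C | (c x == b) && all (fun p => c p.1 == p.2) s] =
  halfspace [set c in C | all (fun p => c p.1 == p.2) s] x b.
  exact: extremal_halfspace.
by apply/setP => c; rewrite !inE -andbA; congr andb; rewrite andbC.
Qed.

Lemma hullS C (P Q : {set concept n}) : P \subset Q -> hull C P \subset hull C Q.
Proof.
move=> PQ; apply/subsetP => c; rewrite !inE => /andP[-> /forallP h] /=.
apply/forallP => p; apply/implyP => /forall_inP hQ.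
apply: implyP (h p) _; apply/forall_inP => a aP; apply: hQ.
exact: subsetP PQ _ aP.
Qed.

Lemma hull_sub C P : hull C P \subset C.
Proof. by apply/subsetP => c; rewrite inE => /andP[]. Qed.

Lemma sub_hull C (P : {set concept n}) : P \subset C -> P \subset hull C P.
Proof.
move=> PC; apply/subsetP => c cP; rewrite inE (subsetP PC) //=.
by apply/forallP=> p; apply/implyP => /forall_inP; apply.
Qed.

Lemma convex_class C : convex C C.
Proof. by apply/existsP; exists set0; rewrite sub0set big_set0 setIT eqxx. Qed.

Lemma convex_halfspace C x b : convex C (halfspace C x b).
Proof.
apply/existsP; exists [set halfspace C x b]; rewrite big_set1; apply/andP; split.
  by rewrite sub1set; apply/imset2P; exists x b.
rewrite eq_sym; apply/eqP/setIidPr.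
by apply/subsetP => c; rewrite in_halfspace => /andP[].
Qed.

Lemma conv_hull C (P : {set concept n}) : P \subset C -> conv C P = hull C P.
Proof.
move=> PC; apply/setP => c; apply/bigcapP/idP => [h|].
  have cC : c \in C by apply: h; rewrite convex_class.
  rewrite inE cC; apply/forallP => -[x b] /=; apply/implyP => /forall_inP hb.
  have: c \in halfspace C x b.
    apply: h; rewrite convex_halfspace; apply/subsetP => a aP.
    by rewrite in_halfspace (subsetP PC) //= hb.
  by rewrite in_halfspace => /andP[].
rewrite inE => /andP[cC /forallP h] K /andP[/existsP[F /andP[/subsetP sF /eqP ->]]].
move=> sP; rewrite inE cC; apply/bigcapP => H HF.
have /imset2P[x b _ _ eH] := sF _ HF; rewrite eH in_halfspace cC.
apply: (implyP (h (x, b))); apply/forall_inP => a /(subsetP sP).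
by rewrite inE => /andP[_ /bigcapP/(_ _ HF)]; rewrite eH in_halfspace => /andP[].
Qed.

(** Independence speaks of partitions; two disjoint subsets reduce to one by enlarging [J] to
    [P :\: I], since hulls are monotone. *)
Lemma radon_independent_hull C (P I J : {set concept n}) :
    P \subset C -> radon_independent C P -> I \subset P -> J \subset P ->
    [disjoint I & J] -> I != set0 -> J != set0 ->
  hull C I :&: hull C J = set0.
Proof.
move=> PC /forallP/(_ I)/forallP/(_ (P :\: I))/implyP h sI sJ dIJ I0 J0.
have sJ' : J \subset P :\: I by rewrite subsetD sJ disjoint_sym.
apply/eqP; rewrite -subset0.
rewrite !conv_hull ?(subset_trans _ PC) ?subsetDl // in h.
rewrite -(eqP (h _)) ?setIS ?hullS //; apply/and4P; split=> //.
- by rewrite setDE setUIr setUCr setIT (setUidPr sI).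
- by rewrite -setI_eq0 setDE setICA setICr setI0.
- by apply: contraNneq J0 => e; rewrite -subset0 -e.
Qed.

End Shattering.

(** * Cubical chains modulo two *)

Section CubicalChains.
Local Open Scope ring_scope.

(** The terms cancel in pairs; [lo] picks from each orbit of [h] the element of smaller rank. *)
Lemma sum_involution0 (V : zmodType) (I : finType) (P : pred I) (h : I -> I)
    (F : I -> V) :
    (forall v : V, v + v = 0) -> involutive h ->
    (forall i, P i -> [/\ P (h i), h i != i & F (h i) = F i]) ->
  \sum_(i | P i) F i = 0.
Proof.
move=> V2 hK hP; pose lo i := (enum_rank i < enum_rank (h i))%N.
have Ph i : P (h i) = P i by apply/idP/idP => /hP[]; rewrite ?hK.
rewrite (bigID lo) /= [X in _ + X](reindex_inj (inv_inj hK)) /=.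
rewrite [X in _ + X](eq_big (fun i => P i && lo i) F) ?V2 // => i.
  rewrite Ph; case Pi: (P i) => //=; rewrite /lo hK -leqNgt leq_eqVlt.
  case: eqP => // /val_inj/enum_rank_inj e.
  by have [_] := hP _ Pi; rewrite -e eqxx.
by rewrite Ph => /andP[/hP[]].
Qed.

Lemma sum_neq0 (I : finType) (P : pred I) (F : I -> bool) :
  \sum_(i | P i) F i -> exists2 i, P i & F i.
Proof.
case: (pickP (fun i => P i && F i)) => [i /andP[]|h]; first by exists i.
by rewrite big1 // => i Pi; have := h i; rewrite Pi.
Qed.

Variable T : finType.
(** A cell is a subcube: [Some b] fixes a coordinate, [None] leaves it free. Chains have
    coefficients in [bool], taken as the field with two elements. *)
Definition cell := {ffun T -> option bool}.
Definition chain := {ffun cell -> bool}.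
Implicit Types (s t : cell) (x y z : chain) (i j : T).

Definition set_coord s i (o : option bool) : cell :=
  [ffun j => if j == i then o else s j].

Lemma set_coordE s i o j : set_coord s i o j = if j == i then o else s j.
Proof. by rewrite ffunE. Qed.

Lemma set_coordK s i o o' : set_coord (set_coord s i o) i o' = set_coord s i o'.
Proof. by apply/ffunP=> j; rewrite !ffunE; case: eqP. Qed.

Lemma set_coord_id s i : set_coord s i (s i) = s.
Proof. by apply/ffunP=> j; rewrite !ffunE; case: eqP => // ->. Qed.

Lemma set_coordC s i j o o' : i != j ->
  set_coord (set_coord s i o) j o' = set_coord (set_coord s j o') i o.
Proof.
move=> ij; apply/ffunP=> l; rewrite !ffunE; case: (eqVneq l j) => // ->.
by rewrite eq_sym (negbTE ij).
Qed.

(** The coefficient at [t] collects the cells having [t] as a facet; each arises by freeing one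
    fixed coordinate of [t]. *)
Definition bd x : chain :=
  [ffun t : cell => \sum_(i | t i != None) x (set_coord t i None)].

Definition vertex s := [forall i, s i != None].

Definition aug x : bool := \sum_(s | vertex s) x s.

Lemma bdE x t : bd x t = \sum_(i | t i != None) x (set_coord t i None).
Proof. by rewrite ffunE. Qed.

Lemma addFF (x : bool) : x + x = 0.
Proof. exact: addbb. Qed.

Lemma addCC x : x + x = 0.
Proof. by apply/ffunP=> s; rewrite !ffunE; exact: addFF. Qed.

Lemma oppC x : - x = x.
Proof. by apply/eqP; rewrite eq_sym -addr_eq0 addCC. Qed.

Lemma addC_eq0 x y : x + y = 0 -> x = y.
Proof. by move/eqP; rewrite addr_eq0 oppC => /eqP. Qed.

Lemma bdD x y : bd (x + y) = bd x + bd y.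
Proof.
apply/ffunP=> t; rewrite !ffunE -big_split; apply: eq_bigr => i _.
by rewrite ffunE.
Qed.

Lemma bd0 : bd 0 = 0.
Proof. by apply/ffunP=> t; rewrite !ffunE big1 // => i _; rewrite ffunE. Qed.

Lemma bd_sum (I : finType) (P : pred I) (F : I -> chain) :
  bd (\sum_(i | P i) F i) = \sum_(i | P i) bd (F i).
Proof. exact: (big_morph bd bdD bd0). Qed.

Lemma augD x y : aug (x + y) = aug x + aug y.
Proof.
by rewrite /aug -big_split; apply: eq_bigr => i _; rewrite ffunE.
Qed.

Lemma aug0 : aug 0 = 0.
Proof. by rewrite /aug big1 // => i _; rewrite ffunE. Qed.

Lemma aug_sum (I : finType) (P : pred I) (F : I -> chain) :
  aug (\sum_(i | P i) F i) = \sum_(i | P i) aug (F i).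
Proof. exact: (big_morph aug augD aug0). Qed.

Lemma bd_bd x : bd (bd x) = 0.
Proof.
apply/ffunP=> t; rewrite bdE ffunE.
under eq_bigr do rewrite bdE; rewrite pair_big_dep /=.
apply: (sum_involution0 (h := fun p => (p.2, p.1))); first exact: addFF.
  by case.
case=> i j /= /andP[ti]; rewrite !ffunE; case: (eqVneq j i) => // ji tj.
split; first by rewrite tj.
  by rewrite xpair_eqE (negbTE ji).
by rewrite set_coordC.
Qed.

(** An edge has two ends, and [fl] exchanges them. *)
Lemma aug_bd x : aug (bd x) = 0.
Proof.
rewrite /aug; under eq_bigr do rewrite bdE.
rewrite pair_big_dep /=.
pose fl (p : cell * T) :=
  (set_coord p.1 p.2 (omap negb (p.1 p.2)), p.2).
apply: (sum_involution0 (h := fl)); first exact: addFF.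
  case=> s i; rewrite /fl /= set_coordK ffunE eqxx.
  by case e: (s i) => [b|] /=; rewrite ?negbK -e set_coord_id.
case=> s i /= /andP[/forallP sv si]; split.
- rewrite ffunE eqxx; case e: (s i) => [b|] /=; last by rewrite e in si.
  rewrite andbT; apply/forallP => j; rewrite ffunE.
  by case: (j == i) => //; have := sv j.
- rewrite xpair_eqE negb_and; apply/orP; left; apply/eqP => /ffunP/(_ i).
  by rewrite ffunE eqxx; case: (s i) si => [[]|].
- by rewrite set_coordK.
Qed.

Definition dirac s : chain := [ffun t => t == s].

Lemma aug_dirac s : vertex s -> aug (dirac s) = true.
Proof.
move=> vs; rewrite /aug (bigD1 s) //= ffunE eqxx big1 ?addr0 // => t /andP[_ ts].
by rewrite ffunE (negbTE ts).
Qed.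

Lemma bd_dirac s : vertex s -> bd (dirac s) = 0.
Proof.
move=> /forallP vs; apply/ffunP => t; rewrite bdE ffunE big1 // => i _.
rewrite ffunE; apply/negbTE/eqP => e; have := vs i; rewrite -e ffunE eqxx.
by [].
Qed.

Lemma bd_neq0 x t : bd x t -> exists2 i, t i != None & x (set_coord t i None).
Proof. by rewrite bdE => /sum_neq0. Qed.

Definition cdim s : nat := #|[set i | s i == None]|.

Lemma cdim_set_coord t i : t i != None -> cdim (set_coord t i None) = (cdim t).+1.
Proof.
move=> ti; rewrite /cdim (cardsD1 i) inE ffunE eqxx; congr S; apply: eq_card => j.
by rewrite !inE ffunE; case: (eqVneq j i) => [->|] //=; rewrite (negbTE ti).
Qed.

Lemma vertex_cdim s : vertex s = (cdim s == 0)%N.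
Proof.
rewrite /cdim cards_eq0; apply/forallP/eqP => [h|h i].
  by apply/setP => i; rewrite !inE (negbTE (h i)).
by have /setP/(_ i) := h; rewrite !inE => ->.
Qed.

(** The degree is the dimension plus one, to match the cardinality of a simplex; [homogeneous 0]
    holds of the zero chain only. *)
Definition homogeneous (h : nat) x := forall s, x s -> (cdim s).+1 = h.

(** The boundary lowers the dimension by exactly one, so only the cells of [y] of dimension [h]
    reach the dimension where [z] lives. *)
Lemma homogeneous_filling h y z :
  homogeneous h z -> bd y = z ->
  bd [ffun s => (cdim s == h) && y s] = z.
Proof.
move=> hz ez; rewrite -{}ez in hz *; apply/ffunP => t; rewrite bdE.
have [e|ne] := eqVneq (cdim t).+1 h.
  rewrite bdE; apply: eq_bigr => i ti.
  by rewrite ffunE cdim_set_coord // e eqxx.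
rewrite big1 => [|i ti]; last by rewrite ffunE cdim_set_coord // (negbTE ne).
apply/esym/negbTE; apply: contra ne => bt; exact/eqP/hz.
Qed.

End CubicalChains.

(** * Acyclicity of the cube complex of an extremal class *)

Section Acyclicity.
Variable n : nat.
Local Notation cell := (cell 'I_n).
Local Notation chain := (chain 'I_n).
Implicit Types (C D : {set concept n}) (c : concept n) (s t : cell) (u y z : chain).
Implicit Types (i x : 'I_n) (b : bool).
Local Open Scope ring_scope.

Definition agrees c s := [forall i, (s i == None) || (s i == Some (c i))].

Lemma agreesP c s :
  reflect (forall i b, s i = Some b -> c i = b) (agrees c s).
Proof.
apply: (iffP forallP) => [h i b si|h i].
  by have := h i; rewrite si /= => /eqP[].
by case e: (s i) => [b|] //=; rewrite (h _ _ e).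
Qed.

Definition cell_in C s := [forall c, agrees c s ==> (c \in C)].

Lemma cell_inP C s :
  reflect (forall c, agrees c s -> c \in C) (cell_in C s).
Proof. by apply: (iffP forallP) => h c; apply/implyP; apply: h. Qed.

Definition cell_point s : concept n := [ffun i => odflt false (s i)].

Lemma cell_pointP s : agrees (cell_point s) s.
Proof. by apply/agreesP => i b si; rewrite ffunE si. Qed.

Definition point_cell c : cell := [ffun i => Some (c i)].

Lemma vertex_point c : vertex (point_cell c).
Proof. by apply/forallP => i; rewrite ffunE. Qed.

Lemma cell_in_point C c : c \in C -> cell_in C (point_cell c).
Proof.
move=> cC; apply/cell_inP => c' /agreesP h; suff -> : c' = c by [].
by apply/ffunP => i; apply: h; rewrite ffunE.
Qed.

(** The free coordinates of a cell inside [C] take all patterns, hence form a shattered set. *)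
Lemma cell_in_cdim C s : cell_in C s -> (cdim s <= vc C)%N.
Proof.
move=> /cell_inP h; rewrite /vc /cdim.
apply: (@leq_bigmax_cond _ (shatters C) (fun A : {set 'I_n} => #|A|)).
apply/shattersP => g.
exists [ffun i => odflt (g i) (s i)].
  by apply: h; apply/agreesP => i b si; rewrite ffunE si.
by move=> i; rewrite inE ffunE => /eqP ->.
Qed.

Lemma cell_inS C D s : C \subset D -> cell_in C s -> cell_in D s.
Proof. by move=> /subsetP sCD /cell_inP h; apply/cell_inP => c /h/sCD. Qed.

Lemma cell_in_face C t i o :
  cell_in C (set_coord t i None) -> cell_in C (set_coord t i o).
Proof.
move=> /cell_inP h; apply/cell_inP => c /agreesP hc; apply: h.
apply/agreesP => j b; rewrite ffunE; case: eqP => // ji tj; apply: hc.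
by rewrite ffunE; case: eqP.
Qed.

Definition supported C z := forall s, z s -> cell_in C s.

Lemma supportedS C D z : C \subset D -> supported C z -> supported D z.
Proof. by move=> CD h s /h; exact: cell_inS. Qed.

Lemma supported0 C : supported C 0.
Proof. by move=> s; rewrite ffunE. Qed.

Lemma supportedD C y z : supported C y -> supported C z -> supported C (y + z).
Proof.
move=> hy hz s; rewrite ffunE; case ys: (y s); first by move=> _; exact: hy.
by rewrite add0r; exact: hz.
Qed.

Lemma supported_sum C (I : finType) (P : pred I) (F : I -> chain) :
  (forall k, P k -> supported C (F k)) -> supported C (\sum_(k | P k) F k).
Proof.
move=> h; elim/big_ind: _ => //; [exact: supported0|exact: supportedD].
Qed.

Lemma supported_bd C z : supported C z -> supported C (bd z).
Proof.
move=> h t /bd_neq0[i ti /h]; move/(cell_in_face (t i)).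
by rewrite set_coord_id.
Qed.

Lemma supported_dirac C c : c \in C -> supported C (dirac (point_cell c)).
Proof. by move=> cC s; rewrite ffunE => /eqP->; exact: cell_in_point. Qed.

(** * Filling cycles by cutting along a coordinate *)

Definition restr x b z : chain := [ffun s : cell => (s x == Some b) && z s].

(** At a cell [t] on the side [b], the equation [bd z = 0] balances the one cell crossing in
    direction [x] against those staying on that side. *)
Lemma bd_restr x b z : bd z = 0 ->
  bd (restr x b z) = [ffun t : cell => (t x == Some b) && z (set_coord t x None)].
Proof.
move=> z0; apply/ffunP => t; rewrite bdE ffunE; case: eqP => tx /=; last first.
  rewrite big1 // => i _; rewrite ffunE set_coordE; case: (x == i) => //.
  by case: eqP tx.
have /ffunP/(_ t) := z0; rewrite bdE ffunE (bigD1 x) ?tx //= => e.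
rewrite (bigD1 x) ?tx //= [restr _ _ _ _]ffunE set_coordE eqxx /= add0r.
have -> : z (set_coord t x None) = \sum_(i | (t i != None) && (i != x)) z (set_coord t i None).
  by move: e; case: (z _) => //; case: (\sum_(_ | _) _).
apply: eq_bigr => i /andP[_ ix].
by rewrite ffunE set_coordE (eq_sym x) (negbTE ix) tx eqxx.
Qed.

(** The product of [y] with the edge in direction [x], meant for [y] on the side [false]. *)
Definition prism x y : chain :=
  [ffun s : cell => (s x == None) && y (set_coord s x (Some false))].

Lemma cell_in_link C x s : cell_in (link C x) s ->
  s x = Some false /\ cell_in C (set_coord s x None).
Proof.
move=> /cell_inP h; have sx : s x = Some false.
  have hc c : agrees c s -> c x = false.
    by move/h; rewrite in_link => /and3P[_ _ /eqP].
  case sx: (s x) => [b|].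
    by rewrite -(hc _ (cell_pointP s)) ffunE sx.
  have /hc : agrees [ffun i => odflt true (s i)] s.
    by apply/agreesP => i b si; rewrite ffunE si.
  by rewrite ffunE sx.
split=> //; apply/cell_inP => c /agreesP hc.
have hs c' : (forall i, i != x -> c' i = c i) -> c' x = false -> agrees c' s.
  move=> e e'; apply/agreesP => i b; case: (eqVneq i x) => [->|ix si].
    by rewrite sx e' => -[].
  by rewrite e //; apply: hc; rewrite set_coordE (negbTE ix).
case cx: (c x).
  have /h : agrees (flip x c) s.
    by apply: hs; rewrite ?flipx ?cx // => i; exact: flip_neq.
  by rewrite in_link flipK => /and3P[].
have /h : agrees c s by exact: hs.
by rewrite in_link => /and3P[].
Qed.

Lemma link_cell_in C x s : s x = Some false -> cell_in C (set_coord s x None) ->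
  cell_in (link C x) s.
Proof.
move=> sx /cell_inP h; apply/cell_inP => c /agreesP hc; rewrite in_link.
rewrite (hc _ _ sx) eqxx andbT; apply/andP; split; apply: h; apply/agreesP => i b.
  by rewrite set_coordE; case: eqP => // _; exact: hc.
by rewrite set_coordE; case: eqVneq => // ix; rewrite flip_neq //; exact: hc.
Qed.

(** The Leibniz rule for a product with an edge: the two ends are copies of [y], and the crossing
    part is the prism over [bd y]. *)
Lemma bd_prism C x y t : supported (link C x) y ->
  bd (prism x y) t = match t x with
    | None => bd y (set_coord t x (Some false))
    | Some false => y t
    | Some true => y (set_coord t x (Some false))
    end.
Proof.
move=> hy; have yN s : s x != Some false -> y s = false.
  by move=> sx; apply/negbTE; apply: contra sx => /hy/cell_in_link[-> _].
case tx: (t x) => [b|].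
  rewrite bdE (bigD1 x) ?tx //= ffunE set_coordE eqxx set_coordK big1 ?addr0 /=.
    by case: b tx => // tx; rewrite -tx set_coord_id.
  by move=> i /andP[_ ix]; rewrite ffunE set_coordE (eq_sym x) (negbTE ix) tx.
rewrite !bdE [RHS](bigD1 x) ?set_coordE ?eqxx //= yN ?set_coordE ?eqxx //.
rewrite add0r; apply: eq_big => [i|i ti].
  by rewrite set_coordE; case: (eqVneq i x) => [->|]; rewrite ?tx ?andbT.
have ix : i != x by apply: contraNneq ti => ->; rewrite tx.
by rewrite ffunE set_coordE (eq_sym x) (negbTE ix) tx /= set_coordC.
Qed.

Lemma supported_prism C x y : supported (link C x) y -> supported C (prism x y).
Proof.
move=> h s; rewrite ffunE => /andP[/eqP sx /h/cell_in_link[_]].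
by rewrite set_coordK -sx set_coord_id.
Qed.

Lemma supported_restr C x b z : supported C z -> supported (halfspace C x b) (restr x b z).
Proof.
move=> h s; rewrite ffunE => /andP[/eqP sx /h/cell_inP hs]; apply/cell_inP => c hc.
by rewrite in_halfspace hs //= ; move/agreesP: hc => /(_ _ _ sx)->.
Qed.

Lemma halfspaceS C x b : halfspace C x b \subset C.
Proof. by apply/subsetP => c; rewrite in_halfspace => /andP[]. Qed.

(** A cell with a free coordinate holds two concepts, so only a single vertex can occur, and [aug]
    reads off its coefficient. *)
Lemma cycle_small C z :
  (#|C| <= 1)%N -> supported C z -> aug z = 0 -> z = 0.
Proof.
move=> /card_le1_eqP C1 hz az; apply/ffunP => s0; rewrite [RHS]ffunE.
apply/negbTE/negP => zs0.
have inC s : z s -> forall c c', agrees c s -> agrees c' s -> c = c'.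
  by move=> /hz/cell_inP hs c c' /hs ? /hs ?; exact: C1.
have zv s : z s -> vertex s /\ s = point_cell (cell_point s).
  move=> zs; have sv i : s i != None.
    apply/eqP => si; have e := inC s zs [ffun i => odflt true (s i)] _ _ (cell_pointP s).
    have/ffunP/(_ i) : [ffun i => odflt true (s i)] = cell_point s.
      by apply: e; apply/agreesP => j b sj; rewrite ffunE sj.
    by rewrite !ffunE si.
  split; first exact/forallP.
  by apply/ffunP=> i; rewrite !ffunE; case: (s i) (sv i).
have [v0 e0] := zv _ zs0.
move: az; rewrite /aug (bigD1 s0) //= zs0 big1 // => s /andP[_ ss0].
apply/negbTE; apply: contra ss0 => zs; have [_ ->] := zv _ zs; rewrite e0.
apply/eqP; congr point_cell; apply: C1; [move/hz: zs0|move/hz: zs].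
all: by move/cell_inP; apply; exact: cell_pointP.
Qed.

(** A Mayer-Vietoris induction on [#|C|]: the two sides of a coordinate are glued along the link,
    and all three are smaller and extremal. *)
Lemma extremal_filling C z : extremal C ->
    supported C z -> bd z = 0 -> aug z = 0 ->
  exists2 y, supported C y & bd y = z.
Proof.
elim/ltn_ind: {C}#|C| {-2}C (erefl #|C|) z => m IH C Cm z eC sz bz az.
have [C1|C1] := leqP #|C| 1.
  by exists 0; [exact: supported0|rewrite bd0 (cycle_small C1 sz az)].
have [x [h0 h1]] := split_coordinate C1.
have /set0Pn[v vL] := extremal_link_neq0 eC h0 h1.
have cardh b : (#|halfspace C x b| < m)%N.
  by move: h0 h1; rewrite -!card_gt0 -Cm -(card_halfspaces C x); case: b; lia.
have cardl : (#|link C x| < m)%N.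
  by apply: leq_ltn_trans (cardh false); apply: subset_leq_card; exact: subsetIl.
(* The boundary of the [false] side is the trace on the link of the cells of [z] crossing in
   direction [x]. *)
pose z' := bd (restr x false z).
have [y0 sy0 by0] : exists2 y, supported (link C x) y & bd y = z'.
  apply: IH cardl _ (erefl _) _ _ _ _ _; [exact: extremal_link| |exact: bd_bd|exact: aug_bd].
  move=> t; rewrite /z' bd_restr // ffunE => /andP[/eqP tx /sz].
  exact: link_cell_in.
(* Adding a vertex [v] of the nonempty link corrects the augmentation of [y0] without changing its
   boundary. *)
have [y [sy dy ay]] : exists y, [/\ supported (link C x) y, bd y = z'
    & aug y = aug (restr x false z)].
  have [e|ne] := eqVneq (aug y0) (aug (restr x false z)); first by exists y0.
  exists (y0 + dirac (point_cell v)); split.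
  - by apply: supportedD => //; exact: supported_dirac.
  - by rewrite bdD by0 bd_dirac ?addr0 //; exact: vertex_point.
  - rewrite augD aug_dirac; last exact: vertex_point.
    by move: ne; case: (aug _) (aug _) => [] [].
(* The prism cancels all crossing cells of [z], so that [u] falls apart into cycles on the two
   sides. *)
pose u := z + bd (prism x y).
have su : supported C u.
  by apply: supportedD => //; apply: supported_bd; exact: supported_prism.
have bu : bd u = 0 by rewrite bdD bz bd_bd addr0.
have uN t : t x = None -> u t = false.
  move=> tx; rewrite ffunE (bd_prism _ sy) tx dy /z' bd_restr // ffunE.
  rewrite set_coordE !eqxx set_coordK -tx set_coord_id; exact: addFF.
have bub b : bd (restr x b u) = 0.
  rewrite bd_restr //; apply/ffunP => t; rewrite [LHS]ffunE [RHS]ffunE uN ?andbF //.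
  by rewrite set_coordE eqxx.
have au0 : aug (restr x false u) = 0.
  suff -> : restr x false u = restr x false z + y by rewrite augD ay addFF.
  apply/ffunP => t; rewrite [LHS]ffunE [u t]ffunE (bd_prism _ sy) [RHS]ffunE [restr _ _ _ _]ffunE.
  case: eqP => [->|/eqP tx] //=; rewrite add0r; apply/esym/negbTE.
  by apply: contra tx => /sy/cell_in_link[-> _].
have uE : u = restr x false u + restr x true u.
  apply/ffunP => t; rewrite [RHS]ffunE [X in X + _]ffunE [X in _ + X]ffunE.
  case tx: (t x) => [[]|] /=.
  - by rewrite add0r.
  - by rewrite addr0.
  - by rewrite uN.
have au1 : aug (restr x true u) = 0.
  have : aug u = 0 by rewrite augD az aug_bd addr0.
  by rewrite [in aug u]uE augD au0 add0r.
have fill b : exists2 w, supported C w & bd w = restr x b u.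
  have [||||w sw bw] := IH _ (cardh b) _ (erefl _) (restr x b u).
  - exact: extremal_halfspace.
  - exact: supported_restr.
  - exact: bub.
  - by case: b {cardh}.
  by exists w => //; apply: supportedS sw; exact: halfspaceS.
have [w0 sw0 bw0] := fill false; have [w1 sw1 bw1] := fill true.
exists (w0 + w1 + prism x y).
  by apply: supportedD; [exact: supportedD|exact: supported_prism].
by rewrite !bdD bw0 bw1 -uE /u -addrA addCC addr0.
Qed.

End Acyclicity.

(** * The deleted product and its involution *)

Section Product.
Variable T : finType.
Local Notation chain2 := (chain (T + T)%type).
Local Notation cell2 := (cell (T + T)%type).
Implicit Types (t : cell2) (v w z : chain2) (x y : chain T).
Local Open Scope ring_scope.

(** A pair of cells is one cell over [T + T], so that the product of complexes reuses [bd] and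
    [aug]. *)
Definition lpart t : cell T := [ffun i => t (inl i)].
Definition rpart t : cell T := [ffun i => t (inr i)].

Lemma lpart_setl t i o : lpart (set_coord t (inl i) o) = set_coord (lpart t) i o.
Proof. by apply/ffunP => j; rewrite !ffunE. Qed.
Lemma rpart_setl t i o : rpart (set_coord t (inl i) o) = rpart t.
Proof. by apply/ffunP => j; rewrite !ffunE. Qed.
Lemma lpart_setr t i o : lpart (set_coord t (inr i) o) = lpart t.
Proof. by apply/ffunP => j; rewrite !ffunE. Qed.
Lemma rpart_setr t i o : rpart (set_coord t (inr i) o) = set_coord (rpart t) i o.
Proof. by apply/ffunP => j; rewrite !ffunE. Qed.

Definition cross x y : chain2 := [ffun t => x (lpart t) * y (rpart t)].

Lemma crossE x y t : cross x y t = x (lpart t) * y (rpart t).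
Proof. by rewrite ffunE. Qed.

Lemma bd_cross x y : bd (cross x y) = cross (bd x) y + cross x (bd y).
Proof.
apply/ffunP => t; rewrite bdE big_sumType /= ffunE !crossE !bdE mulr_suml mulr_sumr.
congr (_ + _); apply: eq_big => i; rewrite ?ffunE // => _.
  by rewrite lpart_setl rpart_setl.
by rewrite lpart_setr rpart_setr.
Qed.

Lemma cross_suml (I : finType) (P : pred I) (F : I -> chain T) y :
  cross (\sum_(i | P i) F i) y = \sum_(i | P i) cross (F i) y.
Proof.
apply/ffunP => t; rewrite crossE !sum_ffunE mulr_suml.
by apply: eq_bigr => i _; rewrite crossE.
Qed.

Lemma cross_sumr (I : finType) (P : pred I) x (F : I -> chain T) :
  cross x (\sum_(i | P i) F i) = \sum_(i | P i) cross x (F i).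
Proof.
apply/ffunP => t; rewrite crossE !sum_ffunE mulr_sumr.
by apply: eq_bigr => i _; rewrite crossE.
Qed.

Lemma cross0r x : cross x 0 = 0.
Proof. by apply/ffunP => t; rewrite crossE !ffunE mulr0. Qed.

Lemma cross0l y : cross 0 y = 0.
Proof. by apply/ffunP => t; rewrite crossE !ffunE mul0r. Qed.

Lemma aug_cross_dirac (p q : cell T) : vertex p -> vertex q ->
  aug (cross (dirac p) (dirac q)) = true.
Proof.
move=> /forallP vp /forallP vq.
pose pq : cell2 := [ffun s => match s with inl i => p i | inr i => q i end].
have -> : cross (dirac p) (dirac q) = dirac pq.
  apply/ffunP => t; rewrite crossE !ffunE; apply/andP/eqP => [[/eqP ep /eqP eq]|->].
    by apply/ffunP => -[] i; rewrite !ffunE -?ep -?eq ffunE.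
  by split; apply/eqP/ffunP => i; rewrite !ffunE.
by apply: aug_dirac; apply/forallP => -[] i; rewrite ffunE.
Qed.

Definition swapi (s : T + T) : T + T := match s with inl i => inr i | inr i => inl i end.

Lemma swapiK : involutive swapi. Proof. by case. Qed.

Definition swapc t : cell2 := [ffun s => t (swapi s)].

Lemma swapcK : involutive swapc.
Proof. by move=> t; apply/ffunP => s; rewrite !ffunE swapiK. Qed.

Definition swap z : chain2 := [ffun t => z (swapc t)].

Lemma swapE z t : swap z t = z (swapc t). Proof. by rewrite ffunE. Qed.

Lemma swapK : involutive swap.
Proof. by move=> z; apply/ffunP => t; rewrite !swapE swapcK. Qed.

Lemma swapD v w : swap (v + w) = swap v + swap w.
Proof. by apply/ffunP => t; rewrite !ffunE. Qed.

Lemma swap0 : swap 0 = 0.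
Proof. by apply/ffunP => t; rewrite !ffunE. Qed.

Lemma swap_sum (I : finType) (P : pred I) (F : I -> chain2) :
  swap (\sum_(i | P i) F i) = \sum_(i | P i) swap (F i).
Proof. exact: (big_morph swap swapD swap0). Qed.

Lemma swap_cross x y : swap (cross x y) = cross y x.
Proof.
apply/ffunP => t; rewrite swapE !crossE mulrC; congr (y _ * x _).
  by apply/ffunP => i; rewrite !ffunE.
by apply/ffunP => i; rewrite !ffunE.
Qed.

Lemma bd_swap z : bd (swap z) = swap (bd z).
Proof.
apply/ffunP => t; rewrite swapE !bdE [RHS](reindex_inj (inv_inj swapiK)) /=.
apply: eq_big => s; first by rewrite ffunE swapiK.
move=> _; rewrite swapE; congr (z _); apply/ffunP => r; rewrite !ffunE.
by rewrite (can2_eq swapiK swapiK).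
Qed.

Lemma aug_swap z : aug (swap z) = aug z.
Proof.
rewrite /aug [RHS](reindex_inj (inv_inj swapcK)) /=.
apply: eq_big => t; last by rewrite swapE.
apply/forallP/forallP => h s; first by rewrite ffunE.
by have := h (swapi s); rewrite ffunE swapiK.
Qed.

(** Some coordinate puts the two factors on opposite sides, so they are disjoint subcubes: these are
    the cells of the deleted product. *)
Definition apart t := [exists i, exists b,
  (t (inl i) == Some b) && (t (inr i) == Some (~~ b))].

Lemma apartP t : reflect (exists i b, t (inl i) = Some b /\ t (inr i) = Some (~~ b))
  (apart t).
Proof.
apply: (iffP existsP) => [[i /existsP[b /andP[/eqP ? /eqP ?]]]|[i [b [hl hr]]]].
  by exists i, b.
by exists i; apply/existsP; exists b; rewrite hl hr !eqxx.
Qed.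

Definition off_diagonal z := forall t, z t -> apart t.

Lemma off_diagonal0 : off_diagonal 0.
Proof. by move=> t; rewrite ffunE. Qed.

Lemma off_diagonalD v w : off_diagonal v -> off_diagonal w -> off_diagonal (v + w).
Proof.
move=> hv hw t; rewrite ffunE; case vt: (v t); first by move=> _; exact: hv.
by rewrite add0r; exact: hw.
Qed.

Lemma off_diagonal_sum (I : finType) (P : pred I) (F : I -> chain2) :
  (forall i, P i -> off_diagonal (F i)) -> off_diagonal (\sum_(i | P i) F i).
Proof.
move=> h; elim/big_ind: _ => //; [exact: off_diagonal0|exact: off_diagonalD].
Qed.

Lemma off_diagonal_bd z : off_diagonal z -> off_diagonal (bd z).
Proof.
move=> hz t /bd_neq0[s _ /hz/apartP[i [b []]]]; rewrite !ffunE.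
case: eqP => // _ hl; case: eqP => // _ hr; apply/apartP; by exists i, b.
Qed.

(** The involution fixes no cell that is [apart], so [v] may take one cell from each orbit, here the
    one of smaller rank. *)
Lemma symmetric_split z : off_diagonal z -> swap z = z ->
  exists2 v, off_diagonal v & z = v + swap v.
Proof.
move=> oz sz; exists [ffun t => z t && (enum_rank t < enum_rank (swapc t))%N].
  by move=> t; rewrite ffunE => /andP[/oz].
apply/ffunP => t; rewrite !ffunE swapcK.
have -> : z (swapc t) = z t by rewrite -swapE sz.
case zt: (z t) => //=.
have/apartP[i [b [hl hr]]] := oz _ zt.
case: ltngtP => // /val_inj/enum_rank_inj/ffunP/(_ (inl i)).
by rewrite ffunE /= hl hr; case: b {hl hr}.
Qed.

(** * Spheres of complementary pairs of faces of a simplex *)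

Section Simplex.
Variables (I : finType) (f : {set I} -> chain T).
Hypothesis f0 : f set0 = 0.
Hypothesis bdf : forall A, bd (f A) = \sum_(a in A) f (A :\ a).
Implicit Types (A B W : {set I}) (a b : I).

(** The image of the fundamental class of the deleted product of the simplex on [W], a sphere of
    dimension [#|W| - 2] with antipodal map [swap]. Terms with an empty factor vanish by [f0]. *)
Definition sphere W : chain2 :=
  \sum_(A : {set I} | A \subset W) cross (f A) (f (W :\: A)).

(** For [a] outside [W], the part of the sphere on [a |: W] with [a] on the left. *)
Definition hemisphere a W : chain2 :=
  \sum_(A : {set I} | A \subset W) cross (f (a |: A)) (f (W :\: A)).

(** Deleting [a] gives the equator. Deleting [b] in [W] gives each pair twice, once from either
    factor that could have held [b]. *)
Lemma bd_hemisphere a W : a \notin W -> bd (hemisphere a W) = sphere W.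
Proof.
move=> aW; rewrite bd_sum.
pose F (p : {set I} * I) := cross (f (a |: p.1 :\ p.2)) (f (W :\: p.1 :\ p.2)).
have step A : A \subset W -> bd (cross (f (a |: A)) (f (W :\: A))) =
    cross (f A) (f (W :\: A)) + \sum_(b in W) F (A, b).
  move=> AW; have aA : a \notin A by apply: contra aW; exact: subsetP.
  rewrite bd_cross !bdf cross_suml cross_sumr big_setU1 //= setU1K // -addrA.
  congr (_ + _); rewrite [RHS](big_setID A) /= (setIidPr AW); congr (_ + _).
    apply: eq_bigr => b bA; rewrite /F /=; congr (cross (f _) (f _)).
      apply/setP => c; rewrite !inE; case: (eqVneq c b) => //= ->.
      by case: eqP => // ba; rewrite -ba bA in aA.
    by apply/setP => c; rewrite !inE; case: (eqVneq c b) => //= ->; rewrite bA.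
  apply: eq_bigr => b; rewrite inE => /andP[bA bW]; rewrite /F /=.
  congr (cross (f _) (f _)).
  by apply/setP => c; rewrite !inE; case: (eqVneq c b) => //= ->; rewrite (negbTE bA).
rewrite (eq_bigr _ step) big_split /= pair_big_dep /=.
(* [h] moves [b] to the other factor, which leaves [F] unchanged. *)
pose h (p : {set I} * I) := (if p.2 \in p.1 then p.1 :\ p.2 else p.2 |: p.1, p.2).
rewrite [X in _ + X](_ : _ = 0) ?addr0 //.
rewrite (eq_bigr F) => [|[]//].
apply: (sum_involution0 (h := h)); first exact: addCC.
  move=> [A b]; rewrite /h /=; case bA: (b \in A); first by rewrite setD11 setD1K.
  by rewrite setU11 setU1K // bA.
move=> [A b] /andP[/= AW bW]; rewrite /h /=; split.
- rewrite bW andbT; case: ifP => _; first exact: subset_trans (subsetDl _ _) AW.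
  by rewrite subUset sub1set bW.
- rewrite xpair_eqE eqxx andbT; case: ifP => bA.
    by apply: contraTneq bA => <-; rewrite setD11.
  by apply: contraFneq bA => <-; rewrite setU11.
- rewrite /F /=; congr (cross (f (_ |: _)) (f _)); apply/setP => c; rewrite !inE.
    by case: (eqVneq c b) => //= cb; case: ifP; rewrite !inE (negbTE cb).
  by case: (eqVneq c b) => //= cb; case: ifP; rewrite !inE (negbTE cb).
Qed.

(** Terms are sorted by the factor holding [a]; complementation in [W] turns the second kind into
    the swap of the first. *)
Lemma sphereU1 a W : a \notin W ->
  sphere (a |: W) = hemisphere a W + swap (hemisphere a W).
Proof.
move=> aW; rewrite /sphere (bigID (fun A : {set I} => a \in A)) /=; congr (_ + _).
  rewrite (reindex_onto (fun A : {set I} => a |: A) (fun A => A :\ a)) /=; last first.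
    by move=> A /andP[_ aA]; rewrite setD1K.
  apply: eq_big => A.
    rewrite setU11 andbT; apply/andP/idP => [[sA /eqP e]|AW].
      have aA : a \notin A by rewrite -e setD11.
      by rewrite -(setU1K aA) -(setU1K aW) setSD.
    by rewrite setUS // setU1K //; apply: contra aW; exact: subsetP.
  move=> /andP[_ /eqP e]; congr (cross _ (f _)); apply/setP => c; rewrite !inE.
  by case: (eqVneq c a) => //= ->; rewrite (negbTE aW) andbF.
rewrite swap_sum.
rewrite [RHS](reindex_onto (fun A : {set I} => W :\: A) (fun A => W :\: A)) /=; last first.
  by move=> A AW; rewrite setDDr setDv set0U (setIidPr AW).
apply: eq_big => A.
  apply/andP/andP => [[sA aA]|[sA /eqP e]].
    have AW : A \subset W.
      apply/subsetP => c cA; have := subsetP sA _ cA; rewrite !inE => /orP[/eqP ca|//].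
      by rewrite -ca cA in aA.
    by rewrite subsetDl setDDr setDv set0U (setIidPr AW).
  have AW : A \subset W by rewrite -e subsetDl.
  split; first exact: subset_trans AW (subsetUr _ _).
  by apply: contra aW; exact: subsetP.
move=> /andP[sA aA]; rewrite swap_cross; congr (cross (f _) (f _)).
  apply/setP => c; have := subsetP sA c; rewrite !inE.
  case: (eqVneq c a) => [->|_] /=; first by rewrite (negbTE aA) (negbTE aW).
  by case: (c \in A) (c \in W) => [] [] // /(_ isT).
apply/setP => c; rewrite !inE; case: (eqVneq c a) => [->|_] /=; first by rewrite aA.
by case: (c \in A) (c \in W) => [] [].
Qed.

Hypothesis f1 : forall a, exists2 p, vertex p & f [set a] = dirac p.
Hypothesis f_apart : forall A B, [disjoint A & B] -> off_diagonal (cross (f A) (f B)).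

Lemma off_diagonal_hemisphere a W : a \notin W -> off_diagonal (hemisphere a W).
Proof.
move=> aW; apply: off_diagonal_sum => A AW; apply: f_apart.
rewrite disjoints_subset; apply/subsetP => c; rewrite !inE.
by case/orP => [/eqP->|->//]; rewrite (negbTE aW) andbF.
Qed.

(* The Borsuk-Ulam descent: a hemisphere that is symmetric up to a boundary
   forces the equator's hemisphere to be so too, down to an antipodal pair of
   points, where the augmentation is odd. *)
Lemma hemisphere_asymmetric a W v w : a \notin W -> W != set0 -> off_diagonal v ->
  hemisphere a W <> v + swap v + bd w.
Proof.
move Wm : #|W| => m; elim: m a W v w Wm => [|m IH] a W v w Wm aW W0 ov e.
  by move/eqP: Wm W0; rewrite cards_eq0 => ->.
have [b bW] := set0Pn _ W0; pose W' := W :\ b.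
have bW' : b \notin W' by rewrite setD11.
have WE : W = b |: W' by rewrite setD1K.
have [W'0|W'0] := eqVneq W' set0.
  (* Here [W] is the single point [b]: the hemisphere is one vertex of the product, of augmentation
     one, whereas the right side has augmentation zero. *)
  have := congr1 (@aug _) e; rewrite !augD aug_swap aug_bd addFF addr0.
  rewrite WE W'0 setU0 /hemisphere (bigD1 set0) ?sub0set //= big1 => [|A].
    have [p vp ->] : exists2 p, vertex p & f (a |: set0) = dirac p.
      by rewrite setU0; exact: f1.
    have [q vq ->] : exists2 q, vertex q & f ([set b] :\: set0) = dirac q.
      by rewrite setD0; exact: f1.
    by rewrite addr0 aug_cross_dirac.
  rewrite subset1 => /andP[/orP[/eqP->|->//] _].
  by rewrite setDv f0 cross0r.
have : bd (hemisphere a W) = bd v + swap (bd v).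
  by rewrite e !bdD bd_bd addr0 bd_swap.
rewrite bd_hemisphere // WE sphereU1 // => e2.
(* By [e2] this [u] is invariant under [swap]; once it is split, the former [v] serves as [w] one
   dimension lower. *)
pose u := hemisphere b W' + bd v.
have ou : off_diagonal u.
  by apply: off_diagonalD; [exact: off_diagonal_hemisphere|exact: off_diagonal_bd].
have su : swap u = u.
  apply: addC_eq0; rewrite swapD addrACA [_ + hemisphere _ _]addrC e2.
  by rewrite [swap _ + _]addrC addCC.
have [v' ov' ue] := symmetric_split ou su.
apply: (IH b W' v' v _ bW' W'0 ov').
  by move: Wm; rewrite (cardsD1 b) bW => -[].
by rewrite -ue /u -addrA addCC addr0.
Qed.

End Simplex.
End Product.

(** * The upper bound for extremal classes *)

Section UpperBound.
Variables (n : nat) (C : {set concept n}).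
Hypothesis eC : extremal C.
Variables (I : finType) (p : I -> concept n).
Hypothesis pC : forall a, p a \in C.
Local Open Scope ring_scope.
Implicit Types (A B : {set I}) (a b : I).

Lemma aug_homogeneous (T : finType) h (x : chain T) :
  homogeneous h x -> h != 1%N -> aug x = 0.
Proof.
move=> hx h1; rewrite /aug big1 // => s vs; apply/negbTE/negP => /hx.
by move: vs; rewrite vertex_cdim => /eqP-> h1'; rewrite -h1' in h1.
Qed.

(** The requirements on the value at [A] of a chain map carried by hulls; the last clause normalises
    it at vertices. *)
Definition fills (f : {set I} -> chain 'I_n) A (y : chain 'I_n) :=
  [/\ bd y = \sum_(a in A) f (A :\ a),
      supported (hull C (p @: A)) y,
      homogeneous #|A| y
    & forall a, A = [set a] -> y = dirac (point_cell (p a))].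

(** The boundary of the simplex gives a reduced cycle in the hull of its vertices, and this hull is
    extremal, so [extremal_filling] applies. *)
Lemma simplex_step (f : {set I} -> chain 'I_n) m A :
    f set0 = 0 -> (forall B, (#|B| <= m)%N -> fills f B (f B)) ->
    #|A| = m.+1 ->
  exists y, fills f A y.
Proof.
move=> f0 fP Am; have cardD a : a \in A -> #|A :\ a| = m.
  by move=> aA; move: Am; rewrite (cardsD1 a) aA => -[].
case: (posnP m) => [m0|m0].
  have /cards1P[a Aa] : #|A| == 1%N by rewrite Am m0.
  exists (dirac (point_cell (p a))); rewrite {}Aa; split.
  - by rewrite big_set1 setDv f0 bd_dirac // vertex_point.
  - apply: supported_dirac; rewrite imset_set1; apply: (subsetP (sub_hull _)).
      by rewrite sub1set.
    by rewrite inE.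
  - move=> s; rewrite ffunE cards1 => /eqP->; congr S; apply/eqP.
    by rewrite -vertex_cdim vertex_point.
  - by move=> b /set1_inj->.
pose z := \sum_(a in A) f (A :\ a).
have sz : supported (hull C (p @: A)) z.
  apply: supported_sum => a aA.
  have [_ + _ _] := fP (A :\ a) (eq_leq (cardD a aA)).
  by apply: supportedS; apply: hullS; apply: imsetS; exact: subsetDl.
have hz : homogeneous m z.
  move=> s; rewrite sum_ffunE => /sum_neq0[a aA fs].
  by have [_ _ /(_ s fs) + _] := fP (A :\ a) (eq_leq (cardD a aA)); rewrite cardD.
have bz : bd z = 0.
  rewrite bd_sum.
  under eq_bigr => a aA do have [-> _ _ _] := fP (A :\ a) (eq_leq (cardD a aA)).
  rewrite pair_big_dep /=.
  apply: (sum_involution0 (h := fun q => (q.2, q.1))); first exact: addCC.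
    by case.
  case=> a b /= /andP[aA]; rewrite !inE => /andP[ba bA].
  split; first by rewrite bA aA eq_sym ba.
    by rewrite xpair_eqE (negbTE ba).
  by congr f; apply/setP => c; rewrite !inE; do !bool_congr.
have az : aug z = 0.
  (* For an edge the augmentations of the two ends cancel; otherwise [z] has no vertices. *)
  case: (eqVneq m 1%N) => [m1|]; last exact: aug_homogeneous.
  have /cards2P[a [b [ab Aab]]] : #|A| == 2 by rewrite Am m1.
  rewrite aug_sum Aab big_setU1 ?inE //= big_set1.
  have e1 c : aug (f [set c]) = true.
    have [|_ _ _ /(_ c erefl) ->] := fP [set c]; first by rewrite cards1 m1.
    by rewrite aug_dirac // vertex_point.
  have -> : [set a; b] :\ a = [set b] by rewrite setU1K // inE.
  by rewrite setUC setU1K ?inE 1?eq_sym // !e1.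
have [y sy bdy] := extremal_filling (extremal_hull _ eC) sz bz az.
exists [ffun s => (cdim s == m) && y s]; split.
- exact: homogeneous_filling.
- by move=> s; rewrite ffunE => /andP[_ /sy].
- by move=> s; rewrite ffunE => /andP[/eqP-> _].
- by move=> a Aa; move: Am; rewrite Aa cards1 => -[m0']; rewrite -m0' in m0.
Qed.

(** The method of acyclic carriers, by induction on the size of faces. *)
Lemma simplex_chain_map : exists f : {set I} -> chain 'I_n,
  [/\ f set0 = 0,
      forall A, bd (f A) = \sum_(a in A) f (A :\ a),
      forall A, supported (hull C (p @: A)) (f A),
      forall A, homogeneous #|A| (f A)
    & forall a, f [set a] = dirac (point_cell (p a))].
Proof.
suff /(_ #|I|) [f [f0 fP]] m : exists f : {set I} -> chain 'I_n, f set0 = 0 /\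
    (forall B, (#|B| <= m)%N -> fills f B (f B)).
  exists f; split=> // [A|A|A|a].
  1-3: by case: (fP A (max_card _)).
  by have [_ _ _] := fP [set a] (max_card _); apply.
elim: m => [|m [f [f0 fP]]].
  exists (fun=> 0); split=> // B; rewrite leqn0 cards_eq0 => /eqP->; split.
  - by rewrite bd0 big_set0.
  - exact: supported0.
  - by move=> s; rewrite ffunE.
  - by move=> b /setP/(_ b); rewrite !inE eqxx.
have /fin_all_exists[g gP] A : exists y, #|A| = m.+1 -> fills f A y.
  have [Am|Am] := eqVneq #|A| m.+1; last by exists 0 => Am'; rewrite Am' eqxx in Am.
  by have [y yP] := simplex_step f0 fP Am; exists y.
exists (fun A => if (#|A| <= m)%N then f A else g A); rewrite cards0; split=> // B Bm.
have e : \sum_(b in B) (if (#|B :\ b| <= m)%N then f (B :\ b) else g (B :\ b)) =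
    \sum_(b in B) f (B :\ b).
  apply: eq_bigr => b bB; suff -> : (#|B :\ b| <= m)%N by [].
  by move: Bm; rewrite (cardsD1 b) bB.
rewrite /fills e; case: leqP => Bm'; first exact: fP.
by apply: gP; apply/eqP; rewrite eqn_leq Bm Bm'.
Qed.

(** * Vanishing of the top-dimensional sphere *)

Section Top.
Variable f : {set I} -> chain 'I_n.
Hypothesis f0 : f set0 = 0.
Hypothesis bdf : forall A, bd (f A) = \sum_(a in A) f (A :\ a).
Hypothesis fC : forall A, supported C (f A).
Hypothesis fh : forall A, homogeneous #|A| (f A).
Hypothesis f1 : forall a, f [set a] = dirac (point_cell (p a)).
Hypothesis cardI : #|I| = (2 * vc C + 2)%N.

Lemma swap_sphere (W : {set I}) : swap (sphere f W) = sphere f W.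
Proof.
have [->|/set0Pn[a aW]] := eqVneq W set0.
  suff -> : sphere f set0 = 0 by rewrite swap0.
  by rewrite /sphere big1 // => A; rewrite subset0 => /eqP->; rewrite f0 cross0l.
by rewrite -(setD1K aW) sphereU1 ?setD11 // swapD swapK addrC.
Qed.

Lemma bd_sphere (W : {set I}) : bd (sphere f W) = 0.
Proof.
have [->|/set0Pn[a aW]] := eqVneq W set0.
  by rewrite /sphere big1 ?bd0 // => A; rewrite subset0 => /eqP->; rewrite f0 cross0l.
rewrite -(setD1K aW) sphereU1 ?setD11 // bdD bd_swap bd_hemisphere ?setD11 //.
by rewrite swap_sphere addCC.
Qed.

(** The two degrees add up to [2 * vc C + 2] and neither exceeds [vc C + 1], so both equal it. *)
Lemma sphere_cdim t : sphere f setT t ->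
  cdim (lpart t) = vc C /\ cdim (rpart t) = vc C.
Proof.
rewrite sum_ffunE => /sum_neq0[A _]; rewrite crossE => /andP[fl fr].
have := cell_in_cdim (fC fl); have := cell_in_cdim (fC fr).
have := fh fl; have := fh fr; have := cardsC A.
by rewrite setTD cardI; lia.
Qed.

(* Both factors of the top sphere are top-dimensional, so for a fixed right
   cell it is a reduced cycle of maximal dimension in an acyclic complex. *)
Lemma sphere_top : sphere f setT = 0.
Proof.
pose pr (s t : cell 'I_n) : cell ('I_n + 'I_n)%type :=
  [ffun r => match r with inl i => s i | inr i => t i end].
have lpr s t : lpart (pr s t) = s by apply/ffunP=> i; rewrite !ffunE.
have rpr s t : rpart (pr s t) = t by apply/ffunP=> i; rewrite !ffunE.
have prK t : pr (lpart t) (rpart t) = t by apply/ffunP=> -[] i; rewrite !ffunE.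
apply/ffunP => t0; rewrite [RHS]ffunE; apply/negbTE/negP => nz.
pose t := rpart t0; pose z : chain 'I_n := [ffun s => sphere f setT (pr s t)].
have dt : cdim t = vc C by have [] := sphere_cdim nz.
have zE : z = \sum_A (if f (~: A) t then f A else 0).
  apply/ffunP => s; rewrite ffunE !sum_ffunE; apply: eq_big => A; first by rewrite subsetT.
  by move=> _; rewrite crossE lpr rpr setTD; case: (f (~: A) t); rewrite ?mulr1 ?mulr0 ?ffunE.
have sz : supported C z.
  by rewrite zE; apply: supported_sum => A _; case: ifP => _ //; exact: supported0.
have bz : bd z = 0.
  apply/ffunP => s; have /ffunP/(_ (pr s t)) := bd_sphere setT.
  (* Freeing a coordinate on the right would exceed dimension [vc C], so only the left boundary
     remains. *)
  rewrite bdE big_sumType /= [X in _ + X]big1 ?addr0; last first.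
    move=> i; rewrite ffunE => ti; apply/negbTE/negP => /sphere_cdim[_].
    by rewrite rpart_setr rpr cdim_set_coord // dt; lia.
  rewrite [RHS]ffunE [X in _ -> _ = X]ffunE => <-; rewrite bdE.
  apply: eq_big => i; rewrite ?ffunE // => _; congr (sphere f setT _).
  by rewrite -[RHS]prK lpart_setl rpart_setl lpr rpr.
have ftop : f setT = 0.
  apply/ffunP => s; rewrite [RHS]ffunE; apply/negbTE/negP => fs.
  by have := fh fs; have := cell_in_cdim (fC fs); rewrite cardsT cardI; lia.
have az : aug z = 0.
  (* The augmentation of the slice is the coefficient at [t] of [bd (f setT)]: only singletons [A]
     carry vertices, and their complements are the facets of [setT]. *)
  have /ffunP/(_ t) := bdf setT; rewrite ftop bd0 sum_ffunE ffunE => e.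
  rewrite zE aug_sum (bigID (mem [set [set a] | a in [set: I]])) /=.
  rewrite [X in _ + X]big1 ?addr0 => [|A nA]; last first.
    case: ifP => _; last exact: aug0.
    apply: (aug_homogeneous (@fh A)); apply: contra nA => /cards1P[a ->].
    by apply/imsetP; exists a.
  rewrite big_imset /=; last by move=> a b _ _; exact: set1_inj.
  rewrite [RHS]e; apply: eq_bigr => a _; rewrite setTD.
  case: (f (~: [set a]) t); last exact: aug0.
  by rewrite f1 aug_dirac // vertex_point.
have [y sy by_] := extremal_filling eC sz bz az.
(* A cell of dimension [vc C] in [bd y] would need a cell of dimension [vc C + 1] in [y]. *)
have : bd y (lpart t0) by rewrite by_ ffunE /t prK.
case/bd_neq0 => i li /sy/cell_in_cdim; rewrite cdim_set_coord //.
by have [-> _] := sphere_cdim nz; rewrite ltnn.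
Qed.

End Top.

Lemma radon_partition : #|I| = (2 * vc C + 2)%N ->
  exists A B, [/\ [disjoint A & B], A != set0, B != set0
    & hull C (p @: A) :&: hull C (p @: B) != set0].
Proof.
move=> cardI.
case: (boolP [exists A : {set I}, exists B : {set I}, [&& [disjoint A & B],
    A != set0, B != set0 & hull C (p @: A) :&: hull C (p @: B) != set0]]).
  by case/existsP => A /existsP[B /and4P[]]; exists A, B.
rewrite negb_exists => /forallP h; exfalso.
have {}h A B : [disjoint A & B] -> A != set0 -> B != set0 ->
    hull C (p @: A) :&: hull C (p @: B) = set0.
  move=> dAB A0 B0; apply/eqP; have := h A; rewrite negb_exists => /forallP/(_ B).
  by rewrite dAB A0 B0 /= negbK.
have [f [f0 bdf fP fh f1]] := simplex_chain_map.
have fC A : supported C (f A) by apply: supportedS (fP A); exact: hull_sub.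
have top := sphere_top f0 bdf fC fh f1 cardI.
have fapart A B : [disjoint A & B] -> off_diagonal (cross (f A) (f B)).
  move=> dAB t; rewrite crossE => /andP[fl fr]; case: (boolP (apart t)) => // nt.
  have A0 : A != set0 by apply: contraTneq fl => ->; rewrite f0 ffunE.
  have B0 : B != set0 by apply: contraTneq fr => ->; rewrite f0 ffunE.
  (* Two cells that no coordinate sets apart have a common point: the left value first, then the
     right one, then [false] where both are free. *)
  pose c : concept n := [ffun i => odflt (odflt false (rpart t i)) (lpart t i)].
  have : c \in hull C (p @: A) :&: hull C (p @: B); last by rewrite h // inE.
  have/fP/cell_inP hl := fl; have/fP/cell_inP hr := fr.
  rewrite inE hl ?hr //; apply/agreesP => i b e.
    rewrite ffunE e /=; case e': (lpart t i) => [b'|] //=.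
    apply/eqP/negPn/negP => bb'; apply: (negP nt); apply/apartP; exists i, b'.
    move: e e'; rewrite !ffunE => -> ->; split=> //.
    by case: b b' bb' => [] [].
  by rewrite ffunE e.
have /card_gt0P[a _] : (0 < #|I|)%N by rewrite cardI; lia.
have aT : a \notin ~: [set a] by rewrite !inE eqxx.
have TE : setT = a |: ~: [set a] by rewrite setUCr.
have W0 : ~: [set a] != set0.
  by rewrite -card_gt0; have := cardsC [set a]; rewrite cards1 cardI; lia.
(* The vanishing top sphere is the hemisphere plus its swap, so modulo two they agree. *)
have sE : swap (hemisphere f a (~: [set a])) = hemisphere f a (~: [set a]).
  by apply: addC_eq0; rewrite addrC -sphereU1 // -TE.
have oE := off_diagonal_hemisphere fapart aT.
have [v ov ve] := symmetric_split oE sE.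
apply: (hemisphere_asymmetric f0 bdf _ fapart (v := v) (w := 0) aT W0 ov).
  by move=> b; exists (point_cell (p b)); [exact: vertex_point|].
by rewrite bd0 addr0.
Qed.

End UpperBound.

Lemma radon_number_extremal (n : nat) (C : {set concept n}) :
  extremal C -> radon_number C <= 2 * vc C + 1.
Proof.
move=> eC; apply/bigmax_leqP => P /andP[PC indP]; rewrite leqNgt; apply/negP => hP.
have hk : 2 * vc C + 2 <= #|P| by lia.
pose p (i : 'I_(2 * vc C + 2)) : concept n := enum_val (widen_ord hk i).
have pP i : p i \in P by exact: enum_valP.
have p_inj : injective p by move=> i j /enum_val_inj/(congr1 val)/= /val_inj.
have [||A [B [dAB A0 B0 /negP]]] := radon_partition eC (p := p).
- by move=> i; exact: subsetP PC _ (pP i).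
- by rewrite card_ord.
apply; apply/eqP; apply: (radon_independent_hull PC indP).
- by apply/subsetP => _ /imsetP[i _ ->].
- by apply/subsetP => _ /imsetP[i _ ->].
- rewrite disjoints_subset; apply/subsetP => _ /imsetP[i iA ->]; rewrite inE.
  by apply/imsetP => -[j jB /p_inj ij]; rewrite -ij (disjointFr dAB iA) in jB.
- by rewrite imset_eq0.
- by rewrite imset_eq0.
Qed.

(** * Lower bounds, maximum classes and the full cube *)

Section LowerBounds.
Variable n : nat.
Implicit Types (C P : {set concept n}) (S : {set 'I_n}) (c g : concept n) (x : 'I_n).

Lemma hullP C P c :
  reflect (c \in C /\ forall x b, {in P, forall a : concept n, a x = b} -> c x = b)
          (c \in hull C P).
Proof.
rewrite inE; apply: (iffP andP) => -[cC h]; split=> //.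
  move=> x b hx; apply/eqP; have /forallP/(_ (x, b))/implyP := h; apply.
  by apply/forall_inP => a /hx/eqP.
apply/forallP => -[x b]; apply/implyP => /forall_inP hx; apply/eqP/h => a aP.
exact/eqP/hx.
Qed.

(** Bipartitions become an index set and its complement, and hulls unfold into coordinates constant
    on a side. *)
Lemma radon_number_ge C m (p : 'I_m -> concept n) :
    injective p -> (forall i, p i \in C) ->
    (forall (A : {set 'I_m}) c, A != set0 -> ~: A != set0 -> c \in C ->
       (forall x b, {in A, forall i, p i x = b} -> c x = b) ->
       (forall x b, {in ~: A, forall i, p i x = b} -> c x = b) -> False) ->
  m <= radon_number C.
Proof.
move=> p_inj pC h; pose P := [set p i | i : 'I_m].
have PC : P \subset C by apply/subsetP => _ /imsetP[i _ ->].
have {1}-> : m = #|P| by rewrite card_imset // card_ord.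
apply: (@leq_bigmax_cond _ _ (fun P : {set concept n} => #|P|)).
rewrite PC; apply/forallP => I; apply/forallP => J.
apply/implyP => /and4P[/eqP IJ dIJ I0 J0].
have IC : I \subset C by rewrite (subset_trans _ PC) // -IJ subsetUl.
have JC : J \subset C by rewrite (subset_trans _ PC) // -IJ subsetUr.
have PE c : c \in I :|: J -> exists i, c = p i.
  by rewrite IJ => /imsetP[i _ ->]; exists i.
rewrite !conv_hull //; apply/eqP/setP => c; rewrite in_set0 inE.
apply/negP => /andP[/hullP[cC hI] /hullP[_ hJ]].
apply: (h [set i | p i \in I] c) => //.
- have [c' c'I] := set0Pn _ I0; have [|i e] := PE c'; first by rewrite inE c'I.
  by apply/set0Pn; exists i; rewrite inE -e.
- have [c' c'J] := set0Pn _ J0; have [|i e] := PE c'; first by rewrite inE c'J orbT.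
  by apply/set0Pn; exists i; rewrite !inE -e (disjointFl dIJ).
- move=> x b hx; apply: hI => a aI; have [|i e] := PE a; first by rewrite inE aI.
  by rewrite e; apply: hx; rewrite inE -e.
- move=> x b hx; apply: hJ => a aJ; have [|i e] := PE a; first by rewrite inE aJ orbT.
  by rewrite e; apply: hx; rewrite !inE -e (disjointFl dIJ).
Qed.

Lemma vc_shattered C : C != set0 -> exists2 S, shatters C S & #|S| = vc C.
Proof.
move=> C0; have [|S shS e] := @eq_bigmax_cond _ (shatters C) (fun S : {set 'I_n} => #|S|).
  by apply/card_gt0P; exists set0; change (is_true (shatters C set0)); rewrite shatters0.
by exists S.
Qed.

Lemma leq_vc C S : shatters C S -> #|S| <= vc C.
Proof. by move=> sh; apply: (@leq_bigmax_cond _ _ (fun S : {set 'I_n} => #|S|)). Qed.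

(* Each of the 2^(m - 1) - 1 bipartitions of m points is read off at its own
   coordinate of a shattered set. *)
Lemma radon_number_log C : C != set0 -> trunc_log 2 (2 * vc C + 2) <= radon_number C.
Proof.
move=> C0; have [S shS cS] := vc_shattered C0.
have := @trunc_logP 2 (2 * vc C + 2) isT; rewrite addn2 => /(_ isT).
case: (trunc_log _ _) => [//|m] hm.
(* Each bipartition is represented by its side that misses [ord0]. *)
pose D := powerset (~: [set ord0 : 'I_m.+1]) :\ set0.
have cD : #|D| <= #|S|.
  have := cardsD1 set0 (powerset (~: [set ord0 : 'I_m.+1])).
  rewrite powersetE sub0set card_powerset cardsC1 card_ord -/D /= add1n => e.
  by move: hm; rewrite expnS e cS; lia.
(* The coordinates of [S] are matched with the members of [D] in order; surplus ones get the default
   [set0]. *)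
pose Bof x := nth set0 (enum D) (index x (enum S)).
have BofP (B : {set 'I_m.+1}) : B \in D -> exists2 x, x \in S & Bof x = B.
  move=> BD; have lt : index B (enum D) < #|S|.
    by apply: leq_trans cD; rewrite cardE index_mem mem_enum.
  pose x := enum_val (Ordinal lt); exists x; first exact: enum_valP.
  rewrite /Bof /x (enum_val_nth x) index_uniq ?enum_uniq -?cardE //=.
  by rewrite nth_index // mem_enum.
have /fin_all_exists[p pP] (i : 'I_m.+1) :
    exists c, c \in C /\ {in S, forall x, c x = (i \in Bof x)}.
  have /shattersP/(_ [ffun x => i \in Bof x]) [c cC cS'] := shS.
  by exists c; split=> // x xS; rewrite cS' // ffunE.
have sep (A : {set 'I_m.+1}) : A != set0 -> ~: A != set0 ->
    exists x b, {in A, forall i, p i x = b} /\ {in ~: A, forall i, p i x = ~~ b}.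
  move=> A0 A1; have [o|o] := boolP (ord0 \in A).
    have [|x xS Bx] := BofP (~: A); first by rewrite !inE A1 setCS sub1set o.
    exists x, false; split=> i iA; have [_ -> //] := pP i; rewrite Bx ?iA //.
    by rewrite inE iA.
  have [|x xS Bx] := BofP A; first by rewrite !inE A0 -disjoints_subset disjoint_sym disjoints1 o.
  exists x, true; split=> i iA; have [_ -> //] := pP i; rewrite Bx ?iA //.
  by move: iA; rewrite inE => /negbTE.
apply: (radon_number_ge (p := p)).
- move=> i j e; apply/eqP/negPn/negP => ij.
  have [||x [b [h1 h2]]] := sep [set i].
  + by apply/set0Pn; exists i; rewrite inE.
  + by apply/set0Pn; exists j; rewrite !inE eq_sym.
  have := h1 i (set11 i); rewrite e h2 ?inE 1?eq_sym //; by case: (b).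
- by move=> i; have [] := pP i.
- move=> A c A0 A1 _ hA hB; have [x [b [h1 h2]]] := sep A A0 A1.
  by have := hA _ _ h1; rewrite (hB _ _ h2); case: (b).
Qed.

(** * The full cube *)

Lemma vc_full : vc [set: concept n] = n.
Proof.
apply/eqP; rewrite eqn_leq; apply/andP; split.
  by apply/bigmax_leqP => S _; rewrite -[X in _ <= X]card_ord max_card.
have {1}<- : #|[set: 'I_n]| = n by rewrite cardsT card_ord.
by apply: leq_vc; apply/shattersP => g; exists g.
Qed.

(** In the full cube the coordinates of a concept can be chosen freely, so two hulls are disjoint
    only if a single coordinate takes opposite constant values on the two sides. *)
Lemma full_separation P (B : {set concept n}) c0 : radon_independent setT P ->
    c0 \in P -> B \subset P -> c0 \notin B -> B != set0 ->
  exists x, B = [set a in P | a x != c0 x].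
Proof.
move=> indP c0P BP c0B B0.
have dB : [disjoint B & P :\: B] by rewrite -setI_eq0 setDE setICA setICr setI0.
have c0D : c0 \in P :\: B by rewrite inE c0B.
have D0 : P :\: B != set0 by apply/set0Pn; exists c0.
have e := radon_independent_hull (subsetT P) indP BP (subsetDl P B) dB B0 D0.
case: (boolP [exists x, B == [set a in P | a x != c0 x]]).
  by case/existsP => x /eqP Bx; exists x.
rewrite negb_exists => /forallP nosep; exfalso.
pose ct (Q : {set concept n}) x (b : bool) := [forall a in Q, a x == b].
(* Constancy on [B] dictates the value; at the other coordinates [P :\: B] does, whenever it is
   constant there. *)
pose c : concept n := [ffun x => if ct B x true then true else
  if ct B x false then false else ct (P :\: B) x true].
suff : c \in hull setT B :&: hull setT (P :\: B) by rewrite e inE.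
have ctP (Q : {set concept n}) x b : reflect {in Q, forall a : concept n, a x = b} (ct Q x b).
  by apply: (iffP forall_inP) => h a /h /eqP.
have [c1 c1B] := set0Pn _ B0.
rewrite inE; apply/andP; split; apply/hullP; split; rewrite ?inE // => x b hx.
  rewrite ffunE; case: (ctP _ _ _) => [h|h1]; first by rewrite -(h _ c1B) hx.
  case: (ctP _ _ _) => [h|h2]; first by rewrite -(h _ c1B) hx.
  by case: b hx => hx; [case: h1|case: h2].
have c0x : c0 x = b by exact: hx.
have nct : ~ {in B, forall a : concept n, a x = ~~ b}.
  move=> hB; have /eqP := nosep x; apply; apply/setP => a; rewrite inE c0x.
  case aB: (a \in B); first by rewrite (subsetP BP) //= hB //; case: (b).
  case aP: (a \in P) => //=; rewrite hx ?eqxx // inE aB; exact: aP.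
rewrite ffunE; case: b hx c0x nct => hx c0x nct.
  by case: (ctP _ _ _) => // _; case: (ctP _ _ _) => // _; apply/ctP.
case: (ctP _ _ _) => // _; case: (ctP _ _ _) => // _; apply/negP => /ctP/(_ _ c0D).
by rewrite c0x.
Qed.

(** The nonempty subsets of [P :\ c0] each need their own coordinate, so
    [2 ^ (#|P| - 1) - 1 <= n]. *)
Lemma radon_number_full_le : radon_number [set: concept n] <= trunc_log 2 (2 * n + 2).
Proof.
apply/bigmax_leqP => P /andP[_ indP].
have [->|/set0Pn[c0 c0P]] := eqVneq P set0; first by rewrite cards0.
apply: trunc_log_max => //.
have h : #|powerset (P :\ c0) :\ set0| <= n.
  rewrite -[X in _ <= X]card_ord -cardsT.
  apply: leq_trans (leq_imset_card (fun x : 'I_n => [set a in P | a x != c0 x]) _).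
  apply: subset_leq_card; apply/subsetP => B; rewrite !inE => /andP[B0 BP].
  have [||x ->] := full_separation (B := B) indP c0P _ _ B0.
  - exact: subset_trans BP (subsetDl _ _).
  - by apply/negP => /(subsetP BP); rewrite !inE eqxx.
  - by apply/imsetP; exists x.
have := cardsD1 set0 (powerset (P :\ c0)).
rewrite powersetE sub0set card_powerset => e.
by rewrite (cardsD1 c0) c0P /= expnS e; lia.
Qed.

(** * Maximum classes *)

Lemma card_small_sets d :
  #|[set S : {set 'I_n} | #|S| <= d]| = \sum_(0 <= i < d.+1) 'C(n, i).
Proof.
elim: d => [|d IH].
  rewrite big_nat1 bin0 (_ : [set S : {set 'I_n} | #|S| <= 0] = [set set0]) ?cards1 //.
  by apply/setP => S; rewrite !inE leqn0 cards_eq0.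
rewrite big_nat_recr //= -IH -[n in 'C(n, _)]card_ord -card_draws -cardsUI.
rewrite (_ : _ :&: _ = set0) ?cards0 ?addn0.
  by apply: eq_card => S; rewrite !inE leq_eqVlt orbC.
by apply/setP => S; rewrite !inE; case: eqP => [->|_]; rewrite ?ltnn ?andbF.
Qed.

(** Every shattered set has size at most [vc C]; since [C] has as many elements as there are such
    sets, Pajor's inequality leaves none of them out. *)
Lemma maximum_shatters C S : maximum C -> #|S| <= vc C -> shatters C S.
Proof.
move=> mC Sd; pose small := [set S : {set 'I_n} | #|S| <= vc C].
have sub : shattered C \subset small.
  by apply/subsetP => A; rewrite !inE; exact: leq_vc.
have : shattered C == small.
  by rewrite eqEcard sub card_small_sets -mC card_le_shattered.
by move/eqP/setP/(_ S); rewrite !inE Sd.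
Qed.

(* On [vc C + 1] coordinates some pattern [g] is missing while all its
   neighbours occur; hulls of disjoint sets of neighbours could only meet in [g]. *)
Lemma radon_number_maximum C :
  maximum C -> C != [set: concept n] -> vc C + 1 <= radon_number C.
Proof.
move=> mC nC; have dn : (vc C).+1 <= n.
  rewrite ltnNge; apply: contra nC => nd; rewrite -subTset; apply/subsetP => g _.
  have /shattersP/(_ g)[c cC cg] : shatters C setT.
    by apply: maximum_shatters => //; rewrite cardsT card_ord.
  by suff -> : g = c by []; apply/ffunP => x; rewrite cg.
pose w : 'I_(vc C).+1 -> 'I_n := widen_ord dn.
have w_inj : injective w by move=> i j /(congr1 val) /= /val_inj.
pose S := [set w i | i : 'I_(vc C).+1].
have cS : #|S| = (vc C).+1 by rewrite card_imset // card_ord.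
(* [S] has [vc C + 1] elements, so it is not shattered and misses a pattern. *)
have [g gP] : exists g, forall c, c \in C -> ~ {in S, c =1 g}.
  case: (pickP (fun g => [forall c in C, ~~ [forall x in S, c x == g x]])) => [g|h].
    move=> /forall_inP h; exists g => c /h/negP nh e; apply: nh.
    by apply/forall_inP => x xS; rewrite e.
  suff /leq_vc : shatters C S by rewrite cS ltnn.
  apply/shattersP => g; have /negbT := h g; rewrite negb_forall => /existsP[c].
  rewrite negb_imply negbK => /andP[cC /forall_inP e]; exists c => // x xS.
  exact/eqP/e.
have /fin_all_exists[p pP] i : exists c, c \in C /\ {in S :\ w i, c =1 g}.
  have /shattersP/(_ g)[c cC cg] : shatters C (S :\ w i).
    apply: maximum_shatters => //; move: cS; rewrite (cardsD1 (w i)).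
    by rewrite imset_f // add1n => -[->].
  by exists c.
have pg i j : i != j -> p i (w j) = g (w j).
  move=> ij; have [_ -> //] := pP i; rewrite !inE imset_f // andbT.
  by apply: contra ij => /eqP/w_inj->.
have pn i : p i (w i) = ~~ g (w i).
  have [pC pS] := pP i; have [e|] := eqVneq (p i (w i)) (g (w i)); last first.
    by case: (p i _) (g _) => [] [].
  case: (gP _ pC) => x xS.
  by have [->|ne] := eqVneq x (w i); [rewrite e|apply: pS; rewrite !inE ne].
rewrite addn1; apply: (radon_number_ge (p := p)).
- move=> i j e; apply/eqP/negPn/negP => ij; have := pn j.
  by rewrite -e pg //; case: (g _).
- by move=> i; have [] := pP i.
- move=> A c _ _ cC hA hB; apply: (gP c cC) => _ /imsetP[i _ ->].
  (* At [w i] the side without [i] is constantly [g (w i)], which forces [c] to agree with [g] on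
     [S]. *)
  have [iA|iA] := boolP (i \in A); [apply: hB|apply: hA] => j jA; apply: pg.
    by apply: contraTneq jA => ->; rewrite inE iA.
  by apply: contraNneq iA => <-.
Qed.

End LowerBounds.

Theorem theoremC (n : nat) :
  [/\ forall C : {set concept n},
        extremal C -> radon_number C <= 2 * vc C + 1,
      forall C : {set concept n},
        C != set0 -> trunc_log 2 (2 * vc C + 2) <= radon_number C,
      forall C : {set concept n},
        maximum C -> C != [set: concept n] -> vc C + 1 <= radon_number C
    & trunc_log 2 (2 * vc [set: concept n] + 2)
        = radon_number [set: concept n]].
Proof.
split.
- exact: radon_number_extremal.
- exact: radon_number_log.
- exact: radon_number_maximum.
- apply/eqP; rewrite eqn_leq radon_number_log ?vc_full ?radon_number_full_le //.
  by apply/set0Pn; exists [ffun=> false].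
Qed.
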